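(* Let $\{A,S(0),\Pi(0)\}$ be a triple of matrices, where $A$ and $S(0)$ are $n\times n$ and $\Pi(0)=\begin{bmatrix}\vartheta_1 & \vartheta_2\end{bmatrix}$ is $n\times m$ with $n\times h$ blocks $\vartheta_1,\vartheta_2$, satisfying $$AS(0)-S(0)A^*=\Pi(0)\,j\,\Pi(0)^*,\qquad S(0)=S(0)^*.$$ Let $Q$ be an $n\times n$ matrix with $Q^2=A$, and let $f_1,f_2$ be $n\times h$ matrices with $$-\mathrm{i}Q(f_1-f_2)=\vartheta_1,\qquad f_1+f_2=\vartheta_2.$$ For $x\in\mathcal I$ put $$\Lambda_1(x)=-\mathrm{i}Q\big(\mathrm{e}^{\mathrm{i}xQ}f_1-\mathrm{e}^{-\mathrm{i}xQ}f_2\big),\quad \Lambda_2(x)=\mathrm{e}^{\mathrm{i}xQ}f_1+\mathrm{e}^{-\mathrm{i}xQ}f_2,\quad \Pi(x)=\begin{bmatrix}\Lambda_1(x)&\Lambda_2(x)\end{bmatrix},$$ $$S(x)=S(0)+\int_0^x\Lambda_2(\xi)\Lambda_2(\xi)^*\,d\xi .$$ At the points $x$ where $S(x)$ is invertible, define the $h\times h$ matrix function $$\widetilde u(x)=2\big(X_{12}(x)+X_{21}(x)+X_{22}(x)^2\big),\qquad X_{ik}(x)=\Lambda_i(x)^*S(x)^{-1}\Lambda_k(x).$$ Then, at the points of invertibility of $S(x)$ (and for all $t\in\mathbb R$), the $h\times n$ matrix function $$\widetilde\psi(x,t)=\begin{bmatrix}0&I_h\end{bmatrix}\Pi(x)^*S(x)^{-1}\mathrm{e}^{-\mathrm{i}tA}$$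 satisfies the dynamical Schrödinger system $$\mathrm{i}\frac{\partial}{\partial t}\widetilde\psi(x,t)=-\frac{\partial^2}{\partial x^2}\widetilde\psi(x,t)+\widetilde u(x)\widetilde\psi(x,t).$$
   Context: $n,h$ are positive integers and $m=2h$. All matrices have complex entries; $M^*$ is the conjugate transpose, $I_k$ the $k\times k$ identity matrix, $\mathrm i$ the imaginary unit, and $j=\begin{bmatrix}0&I_h\\-I_h&0\end{bmatrix}$ ($m\times m$). $\mathcal I\subset\mathbb R$ is a finite or infinite interval with $0\in\mathcal I$; $x\in\mathcal I$ and $t\in\mathbb R$. *)

(* Defs.v *)
From HB Require Import structures.
From mathcomp Require Import all_boot all_order all_algebra.
From mathcomp Require Import complex.
From mathcomp Require Import all_classical all_reals all_analysis.
Set Implicit Arguments.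
Unset Strict Implicit.
Unset Printing Implicit Defensive.
Import Order.TTheory GRing.Theory Num.Theory.
Import numFieldNormedType.Exports.
Local Open Scope classical_set_scope.
Local Open Scope ring_scope.
Local Open Scope complex_scope.
Local Open Scope sesquilinear_scope.

(* The norm topology of the field R[i], as for any [numFieldType]. *)
HB.instance Definition _ (R : realType) :=
  PseudoPointedMetric.copy R[i] (R[i])^o.
HB.instance Definition _ (R : realType) := NormedModule.copy R[i] (R[i])^o.

Definition expmx (R : realType) (n : nat) (A : 'M[R[i]]_n) : 'M[R[i]]_n :=
  limn (series (fun k : nat => (k`!%:R)^-1 *: A ^+ k)).

(* The library's [derive] needs domain and codomain normed over the same field.
   Here the domain is R and the codomain a space of matrices over R[i], so the
   difference quotient is rescaled through the embedding [_%:C]. *)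
Definition mxquot (R : realType) (p q : nat) (f : R -> 'M[R[i]]_(p, q)) (x : R)
    : R -> 'M[R[i]]_(p, q) :=
  fun s => (s^-1)%:C *: (f (s + x) - f x).

Definition mxderivable (R : realType) (p q : nat)
    (f : R -> 'M[R[i]]_(p, q)) (x : R) : Prop :=
  cvg (mxquot f x @ 0^').

Definition mxderive (R : realType) (p q : nat)
    (f : R -> 'M[R[i]]_(p, q)) (x : R) : 'M[R[i]]_(p, q) :=
  lim (mxquot f x @ 0^').

(* Oriented integral, so that b < a is allowed. *)
Definition oint (R : realType) (f : R -> R) (a b : R) : R :=
  if a <= b then \int[lebesgue_measure]_(y in `[a, b]) f y
  else - \int[lebesgue_measure]_(y in `[b, a]) f y.

Definition mxint (R : realType) (p q : nat)
    (f : R -> 'M[R[i]]_(p, q)) (a b : R) : 'M[R[i]]_(p, q) :=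
  \matrix_(k, l) (oint (fun y => complex.Re (f y k l)) a b
                  +i* oint (fun y => complex.Im (f y k l)) a b).

Definition jmx (R : realType) (h : nat) : 'M[R[i]]_(h + h) :=
  block_mx 0 1%:M (- 1%:M) 0.

Section GBDT.
Context (R : realType) (n h : nat).
Variables (A Q S0 : 'M[R[i]]_n) (f1 f2 : 'M[R[i]]_(n, h)).

Definition Lambda1 (x : R) : 'M[R[i]]_(n, h) :=
  (- 'i) *: (Q *m (expmx (('i * x%:C) *: Q) *m f1
                   - expmx ((- ('i * x%:C)) *: Q) *m f2)).

Definition Lambda2 (x : R) : 'M[R[i]]_(n, h) :=
  expmx (('i * x%:C) *: Q) *m f1 + expmx ((- ('i * x%:C)) *: Q) *m f2.

Definition PiX (x : R) : 'M[R[i]]_(n, h + h) := row_mx (Lambda1 x) (Lambda2 x).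

Definition SX (x : R) : 'M[R[i]]_n :=
  S0 + mxint (fun xi => Lambda2 xi *m (Lambda2 xi)^t*) 0 x.

Definition X12 (x : R) : 'M[R[i]]_h :=
  (Lambda1 x)^t* *m invmx (SX x) *m Lambda2 x.
Definition X21 (x : R) : 'M[R[i]]_h :=
  (Lambda2 x)^t* *m invmx (SX x) *m Lambda1 x.
Definition X22 (x : R) : 'M[R[i]]_h :=
  (Lambda2 x)^t* *m invmx (SX x) *m Lambda2 x.

Definition utilde (x : R) : 'M[R[i]]_h :=
  2 *: (X12 x + X21 x + X22 x *m X22 x).

Definition psitilde (x t : R) : 'M[R[i]]_(h, n) :=
  row_mx 0 1%:M *m (PiX x)^t* *m invmx (SX x)
    *m expmx ((- ('i * t%:C)) *: A).
End GBDT.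

(* Main.v *)
Require Import Defs.
From HB Require Import structures.
From mathcomp Require Import all_boot all_order all_algebra.
From mathcomp Require Import complex.
From mathcomp Require Import all_classical all_reals all_analysis.
From mathcomp Require Import ring.
Set Implicit Arguments.
Unset Strict Implicit.
Unset Printing Implicit Defensive.
Import Order.TTheory GRing.Theory Num.Theory.
Import numFieldNormedType.Exports.
Local Open Scope classical_set_scope.
Local Open Scope ring_scope.
Local Open Scope complex_scope.
Local Open Scope sesquilinear_scope.

(** The functions [Lambda1] and [Lambda2] satisfy the first-order system
    [Lambda2' = - Lambda1], [Lambda1' = A Lambda2], because [Q ^ 2 = A], and by
    construction [S' = Lambda2 (adj Lambda2)], where [adj] is the conjugate
    transpose. Hence the derivative of
    [A S - S (adj A) - (Lambda1 (adj Lambda2) - Lambda2 (adj Lambda1))]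
    vanishes, and the matrix identity assumed at [0] holds at every point
    ([SX_identity]).

    Put [phi = (adj Lambda2) S^-1] and [chi = (adj Lambda1) S^-1], so that
    [psi (x, t) = phi (x) exp (- i t A)]. Wherever [S] is invertible,
    [phi' = - chi - X22 phi]. The derivative of [chi] contains
    [(adj Lambda2) (adj A) S^-1]; the identity for [S], multiplied by [S^-1] on
    both sides, moves [A] to the right and gives
    [chi' = phi A - X21 phi + X22 chi - X12 phi]. Differentiating [phi'] once
    more, the terms in [X22 chi] cancel and
    [phi'' = - phi A + 2 (X12 + X21 + X22 ^ 2) phi]
    ([is_mxderive_phi'], [schrodinger_algebra]). As
    [i d/dt (phi exp (- i t A)) = phi A exp (- i t A)], this is the Schrodinger
    equation.

    The analysis behind this computation concerns matrix functions of a real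
    variable with complex entries. Limits are taken entry by entry ([cvg_mxP])
    and split into real and imaginary parts ([cvg_complexP]). The sum, product,
    inverse and adjoint rules follow from limit theorems for matrices; the
    derivative of the exponential ([is_mxderive_expmx]) and of the integral
    ([is_mxderive_int]) come from the real theorems on power series and on
    integrals of continuous functions. *)

(** * Limits of complex matrices, entry by entry *)

(** A basic neighbourhood of [M] restrains each entry separately, and there are
    finitely many entries. *)
Lemma cvg_mxP (R : realType) (p q : nat) (T : Type) (F : set_system T)
    {FF : Filter F} (f : T -> 'M[R[i]]_(p, q)) (M : 'M[R[i]]_(p, q)) :
  f y @[y --> F] --> M <-> forall k l, f y k l @[y --> F] --> M k l.
Proof.
split=> [fM k l A MA|fM A [P MP PA]].
  apply: (fM [set N | A (N k l)]).
  exists (fun k' l' => if (k' == k) && (l' == l) then A else setT).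
    move=> k' l'; case: ifP => [/andP[/eqP-> /eqP->]//|_]; exact: filterT.
  by move=> N /(_ k l); rewrite !eqxx.
suff : \forall y \near F, forall k l, P k l (f y k l).
  by apply: filterS => y /PA.
apply: filter_forall => k; apply: filter_forall => l.
exact: (fM k l _ (MP k l)).
Qed.

Lemma normc_real (R : realType) (x : R) : `|x%:C| = `|x|%:C.
Proof. by rewrite normc_def /= expr0n addr0 sqrtr_sqr. Qed.

Lemma normc_i (R : realType) : `|'i%C : R[i]| = 1.
Proof. by rewrite normc_def /= expr0n expr1n add0r sqrtr1. Qed.

Lemma normc_ge_Im (R : realType) (z : R[i]) : `|complex.Im z|%:C <= `|z|.
Proof.
rewrite -[complex.Im z]opprK -ReiNIm normrN.
apply: le_trans (normc_ge_Re _) _.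
by rewrite normrM normc_i mulr1.
Qed.

(** Makes the analysis of real-valued functions available for complex entries:
    [|Re z|, |Im z| <= |z| <= |Re z| + |Im z|]. *)
Lemma cvg_complexP (R : realType) (T : Type) (F : set_system T)
    {FF : Filter F} (f : T -> R[i]) (a : R[i]) :
  f y @[y --> F] --> a <->
  (complex.Re (f y) @[y --> F] --> complex.Re a) /\
  (complex.Im (f y) @[y --> F] --> complex.Im a).
Proof.
split.
  move=> /cvgrPdist_lt fa; split; apply/cvgrPdist_lt => e e0;
      have e0' : 0 < e%:C by [rewrite ltcR|];
      apply: filterS (fa _ e0') => y; rewrite -ltcR; apply: le_lt_trans;
      rewrite -raddfB; [exact: normc_ge_Re|exact: normc_ge_Im].
move=> [/cvgrPdist_lt fr /cvgrPdist_lt fi]; apply/cvgrPdist_lt => -[e b].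
rewrite ltcE /= => /andP[/eqP b0 e0]; rewrite b0.
have e2 : 0 < e / 2 by rewrite divr_gt0.
near=> y.
rewrite [a - f y]complexE -[ltRHS]/(e%:C) [e]splitr (rmorphD (real_complex R)).
apply: le_lt_trans (ler_normD _ _) _.
rewrite normrM normc_i mul1r !normc_real !raddfB /= ltrD // ltcR.
- by near: y; exact: fr.
- by near: y; exact: fi.
Unshelve. all: by end_near. Qed.

Lemma adjmxE (R : realType) p q (A : 'M[R[i]]_(p, q)) k l :
  A^t* k l = complex.Re (A l k) -i* complex.Im (A l k).
Proof. by rewrite !mxE; case: (A l k). Qed.

Section MatrixLimits.
Context (R : realType) (T : Type) (F : set_system T) {FF : Filter F}.

Lemma cvg_addmx p q (f g : T -> 'M[R[i]]_(p, q)) (A B : 'M[R[i]]_(p, q)) :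
  f y @[y --> F] --> A -> g y @[y --> F] --> B ->
  f y + g y @[y --> F] --> A + B.
Proof.
move=> /cvg_mxP fA /cvg_mxP gB; apply/cvg_mxP => k l.
by under eq_fun do rewrite mxE; rewrite mxE; apply: cvgD.
Qed.

Lemma cvg_oppmx p q (f : T -> 'M[R[i]]_(p, q)) (A : 'M[R[i]]_(p, q)) :
  f y @[y --> F] --> A -> - f y @[y --> F] --> - A.
Proof.
move=> /cvg_mxP fA; apply/cvg_mxP => k l.
by under eq_fun do rewrite mxE; rewrite mxE; apply: cvgN.
Qed.

Lemma cvg_scalemx p q (c : T -> R[i]) (f : T -> 'M[R[i]]_(p, q))
    (d : R[i]) (A : 'M[R[i]]_(p, q)) :
  c y @[y --> F] --> d -> f y @[y --> F] --> A -> c y *: f y @[y --> F] --> d *: A.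
Proof.
move=> cd /cvg_mxP fA; apply/cvg_mxP => k l.
under eq_fun do rewrite mxE.
rewrite mxE.
exact: (cvgM cd (fA k l)).
Qed.

Lemma cvg_csum (I : Type) (r : seq I) (P : pred I) (f : I -> T -> R[i])
    (a : I -> R[i]) :
  (forall k, P k -> f k y @[y --> F] --> a k) ->
  \sum_(k <- r | P k) f k y @[y --> F] --> \sum_(k <- r | P k) a k.
Proof.
move=> fa; elim: r => [|k r IH].
  by under eq_fun do rewrite big_nil; rewrite big_nil; apply: cvg_cst.
have [Pk|Pk] := boolP (P k); last first.
  under eq_fun do rewrite big_cons (negbTE Pk).
  by rewrite big_cons (negbTE Pk).
under eq_fun do rewrite big_cons Pk.
rewrite big_cons Pk.
exact: (cvgD (fa k Pk) IH).
Qed.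

Lemma cvg_cprod (I : Type) (r : seq I) (P : pred I) (f : I -> T -> R[i])
    (a : I -> R[i]) :
  (forall k, P k -> f k y @[y --> F] --> a k) ->
  \prod_(k <- r | P k) f k y @[y --> F] --> \prod_(k <- r | P k) a k.
Proof.
move=> fa; elim: r => [|k r IH].
  by under eq_fun do rewrite big_nil; rewrite big_nil; apply: cvg_cst.
have [Pk|Pk] := boolP (P k); last first.
  under eq_fun do rewrite big_cons (negbTE Pk).
  by rewrite big_cons (negbTE Pk).
under eq_fun do rewrite big_cons Pk.
rewrite big_cons Pk.
exact: (cvgM (fa k Pk) IH).
Qed.

Lemma cvg_mulmx p q r (f : T -> 'M[R[i]]_(p, q)) (g : T -> 'M[R[i]]_(q, r))
    (A : 'M[R[i]]_(p, q)) (B : 'M[R[i]]_(q, r)) :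
  f y @[y --> F] --> A -> g y @[y --> F] --> B ->
  f y *m g y @[y --> F] --> A *m B.
Proof.
move=> /cvg_mxP fA /cvg_mxP gB; apply/cvg_mxP => k l.
under eq_fun do rewrite mxE; rewrite mxE.
by apply: cvg_csum => i _; apply: cvgM.
Qed.

Lemma cvg_adjmx p q (f : T -> 'M[R[i]]_(p, q)) (A : 'M[R[i]]_(p, q)) :
  f y @[y --> F] --> A -> (f y)^t* @[y --> F] --> A^t*.
Proof.
move=> /cvg_mxP fA; apply/cvg_mxP => k l.
under eq_fun do rewrite adjmxE; rewrite adjmxE.
have /cvg_complexP[fr fi] := fA l k.
by apply/cvg_complexP; split => //=; apply: cvgN.
Qed.

Lemma cvg_det p (f : T -> 'M[R[i]]_p) (A : 'M[R[i]]_p) :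
  f y @[y --> F] --> A -> \det (f y) @[y --> F] --> \det A.
Proof.
move=> /cvg_mxP fA; rewrite /determinant.
apply: cvg_csum => s _; apply: cvgM; first exact: cvg_cst.
by apply: cvg_cprod => k _; apply: fA.
Qed.

(** The determinant is a polynomial in the entries, hence continuous, so it stays
    nonzero near an invertible limit; there the inverse is given by Cramer's
    formula, which passes to the limit. *)
Lemma cvg_invmx p (f : T -> 'M[R[i]]_p) (A : 'M[R[i]]_p) :
  A \in unitmx -> f y @[y --> F] --> A ->
  (\forall y \near F, f y \in unitmx) /\ invmx (f y) @[y --> F] --> invmx A.
Proof.
move=> uA fA; have dA := cvg_det fA.
have A0 : \det A != 0 by move: uA; rewrite unitmxE unitfE.
have nU : \forall y \near F, f y \in unitmx.
  have /cvgrPdist_lt := dA; have : 0 < `|\det A| by rewrite normr_gt0.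
  move=> /[swap] /[apply]; apply: filterS => y; rewrite unitmxE unitfE.
  by apply: contraTneq => ->; rewrite subr0 ltxx.
split; first exact: nU.
have fE : \forall y \near F, (\det (f y))^-1 *: \adj (f y) = invmx (f y).
  by apply: filterS nU => y; rewrite /invmx => ->.
have -> : invmx A = (\det A)^-1 *: \adj A by rewrite /invmx uA.
apply: cvg_trans (near_eq_cvg fE) _.
apply: cvg_scalemx; first exact: (cvgV A0 dA).
have /cvg_mxP fA' := fA.
apply/cvg_mxP => k l; under eq_fun do rewrite !mxE; rewrite !mxE.
apply: cvgM; first exact: cvg_cst.
apply: cvg_det; apply/cvg_mxP => k' l'.
under eq_fun do rewrite !mxE.
rewrite !mxE; exact: fA'.
Qed.

End MatrixLimits.

(** Limits of matrices are unique because those of their entries are, so [lim]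
    can be computed from any convergence. *)
Lemma cvg_mx_lim (R : realType) p q (T : Type) (F : set_system T)
    {FF : ProperFilter F} (f : T -> 'M[R[i]]_(p, q)) (A : 'M[R[i]]_(p, q)) :
  f y @[y --> F] --> A -> lim (f y @[y --> F]) = A.
Proof.
move=> fA; have : cvg (f y @[y --> F]) by apply/cvg_ex; exists A.
move=> /cvg_mxP fL; have /cvg_mxP {}fA := fA.
apply/matrixP => k l; apply: cvg_unique (fL k l) (fA k l).
exact: norm_hausdorff.
Qed.

(** * Derivatives of matrix functions of a real variable *)

(** Existence and value of the derivative in one relation, so that the rules below
    compose; [is_mxderive_val] translates back. *)
Definition is_mxderive (R : realType) p q (f : R -> 'M[R[i]]_(p, q)) (x : R)
    (D : 'M[R[i]]_(p, q)) : Prop :=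
  mxquot f x s @[s --> 0^'] --> D.

Lemma is_mxderive_val (R : realType) p q (f : R -> 'M[R[i]]_(p, q)) x D :
  is_mxderive f x D -> mxderivable f x /\ mxderive f x = D.
Proof.
move=> fD; split; first by apply/cvg_ex; exists D.
exact: cvg_mx_lim fD.
Qed.

Lemma is_deriveE (R : realType) (f : R -> R) (x d : R) :
  is_derive x 1 f d <-> s^-1 * (f (s + x) - f x) @[s --> 0^'] --> d.
Proof.
have E : (fun s => s^-1 *: (f (s *: 1 + x) - f x)) =
         (fun s => s^-1 * (f (s + x) - f x)).
  by apply/funext => s; rewrite [s *: 1]mulr1.
split.
  move=> [df <-]; rewrite -E.
  exact: df.
move=> fd; split.
  by apply/cvg_ex; exists d; rewrite E.
by rewrite /derive E; apply: cvg_lim.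
Qed.

(** The bridge to the theory of real derivatives, used for the exponential, for
    the integral, and for the fact that a null derivative forces constancy. *)
Lemma is_mxderiveP (R : realType) p q (f : R -> 'M[R[i]]_(p, q)) x D :
  is_mxderive f x D <-> forall k l,
    is_derive x 1 (fun y => complex.Re (f y k l)) (complex.Re (D k l)) /\
    is_derive x 1 (fun y => complex.Im (f y k l)) (complex.Im (D k l)).
Proof.
have E k l s : mxquot f x s k l =
    (s^-1 * (complex.Re (f (s + x) k l) - complex.Re (f x k l))) +i*
    (s^-1 * (complex.Im (f (s + x) k l) - complex.Im (f x k l))).
  rewrite /mxquot !mxE.
  by case: (f (s + x) k l) (f x k l) => [a b] [c d]; simpc.
split.
  move=> /cvg_mxP fD k l; have := fD k l.
  under eq_fun do rewrite E.
  by move=> /cvg_complexP[/= fr fi]; split; apply/is_deriveE.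
move=> fD; apply/cvg_mxP => k l; have [/is_deriveE fr /is_deriveE fi] := fD k l.
by under eq_fun do rewrite E; apply/cvg_complexP.
Qed.

Lemma is_mxderive_cvg (R : realType) p q (f : R -> 'M[R[i]]_(p, q)) x D :
  is_mxderive f x D -> f y @[y --> x] --> f x.
Proof.
move=> /is_mxderiveP fD; apply/cvg_mxP => k l; apply/cvg_complexP.
have [[fr _] [fi _]] := fD k l.
by split; apply: differentiable_continuous; apply/derivable1_diffP.
Qed.

Lemma cvg_shift0 (R : realType) (x : R) : s + x @[s --> 0^'] --> x.
Proof.
apply: cvg_trans (_ : s + x @[s --> 0] --> x).
  by apply: cvg_app; apply: cvg_within.
by rewrite -[X in _ --> X]add0r; apply: cvgD; [exact: cvg_id|exact: cvg_cst].
Qed.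

Lemma is_mxderive_shift (R : realType) p q (f : R -> 'M[R[i]]_(p, q)) x D :
  is_mxderive f x D -> f (s + x) @[s --> 0^'] --> f x.
Proof.
move=> /is_mxderive_cvg fx B /fx fB.
exact: (cvg_shift0 fB).
Qed.

(** The second derivative in the theorem is that of a function known only near
    the point, where [S] is still invertible. *)
Lemma is_mxderive_near (R : realType) p q (f g : R -> 'M[R[i]]_(p, q)) x D :
  (\forall y \near x, f y = g y) -> is_mxderive f x D -> is_mxderive g x D.
Proof.
move=> fg fD; have fgx := nbhs_singleton fg.
apply: cvg_trans _ fD; apply: near_eq_cvg.
have fg' : \forall s \near 0^', f (s + x) = g (s + x) := cvg_shift0 fg.
by apply: filterS fg' => s fgs; rewrite /mxquot fgs fgx.
Qed.

Lemma eq_is_mxderive (R : realType) p q (f g : R -> 'M[R[i]]_(p, q)) x D E :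
  is_mxderive f x D -> f =1 g -> D = E -> is_mxderive g x E.
Proof. by move=> fD /funext <- <-. Qed.

Section DerivationRules.
Context (R : realType).
Implicit Type x : R.

Lemma is_mxderive_cst p q (A : 'M[R[i]]_(p, q)) x : is_mxderive (fun=> A) x 0.
Proof.
rewrite /is_mxderive /mxquot; under eq_fun do rewrite subrr scaler0.
exact: cvg_cst.
Qed.

Lemma is_mxderiveD p q (f g : R -> 'M[R[i]]_(p, q)) x D E :
  is_mxderive f x D -> is_mxderive g x E ->
  is_mxderive (fun y => f y + g y) x (D + E).
Proof.
move=> fD gE; rewrite /is_mxderive.
rewrite (_ : mxquot _ _ = fun s => mxquot f x s + mxquot g x s).
  exact: (cvg_addmx fD gE).
by apply/funext => s; rewrite /mxquot -scalerDr addrACA -opprD.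
Qed.

Lemma is_mxderiveN p q (f : R -> 'M[R[i]]_(p, q)) x D :
  is_mxderive f x D -> is_mxderive (fun y => - f y) x (- D).
Proof.
move=> fD; rewrite /is_mxderive.
rewrite (_ : mxquot _ _ = fun s => - mxquot f x s).
  exact: (cvg_oppmx fD).
by apply/funext => s; rewrite /mxquot -scalerN opprD.
Qed.

Lemma is_mxderiveZ p q (c : R[i]) (f : R -> 'M[R[i]]_(p, q)) x D :
  is_mxderive f x D -> is_mxderive (fun y => c *: f y) x (c *: D).
Proof.
move=> fD; rewrite /is_mxderive.
rewrite (_ : mxquot _ _ = fun s => c *: mxquot f x s).
  by apply: cvg_scalemx; [exact: cvg_cst|exact: fD].
by apply/funext => s; rewrite /mxquot -scalerBr !scalerA mulrC.
Qed.

(** The difference quotient of [f *m g] splits as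
    [quot f *m g (s + x) + f x *m quot g], and [g] is continuous at [x]. *)
Lemma is_mxderiveM p q r (f : R -> 'M[R[i]]_(p, q)) (g : R -> 'M[R[i]]_(q, r))
    x D E :
  is_mxderive f x D -> is_mxderive g x E ->
  is_mxderive (fun y => f y *m g y) x (D *m g x + f x *m E).
Proof.
move=> fD gE; rewrite /is_mxderive.
rewrite (_ : mxquot _ _ = fun s => mxquot f x s *m g (s + x) + f x *m mxquot g x s).
  apply: cvg_addmx; apply: cvg_mulmx.
  - exact: fD.
  - exact: is_mxderive_shift gE.
  - exact: cvg_cst.
  - exact: gE.
apply/funext => s; rewrite /mxquot -scalemxAl -scalemxAr -scalerDr.
by rewrite mulmxBl mulmxBr addrA subrK.
Qed.

Lemma is_mxderive_adj p q (f : R -> 'M[R[i]]_(p, q)) x D :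
  is_mxderive f x D -> is_mxderive (fun y => (f y)^t*) x (D^t*).
Proof.
move=> fD; rewrite /is_mxderive.
rewrite (_ : mxquot _ _ = fun s => (mxquot f x s)^t*).
  exact: (cvg_adjmx fD).
apply/funext => s; apply/matrixP => k l.
rewrite /mxquot adjmxE !mxE.
by case: (f (s + x) l k) (f x l k) => [a b] [c d] /=; simpc; congr (_ +i* _); ring.
Qed.

Lemma is_mxderive_near_unit p (f : R -> 'M[R[i]]_p) x D :
  f x \in unitmx -> is_mxderive f x D -> \forall y \near x, f y \in unitmx.
Proof. by move=> ux /is_mxderive_cvg /(cvg_invmx ux)[]. Qed.

(** Rests on [B^-1 - C^-1 = - B^-1 (B - C) C^-1] and on the continuity of the
    inverse. *)
Lemma is_mxderive_inv p (f : R -> 'M[R[i]]_p) x D :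
  f x \in unitmx -> is_mxderive f x D ->
  is_mxderive (fun y => invmx (f y)) x (- (invmx (f x) *m D *m invmx (f x))).
Proof.
move=> ux fD.
have [nU fI] := cvg_invmx ux (is_mxderive_shift fD).
have : - (invmx (f (s + x)) *m mxquot f x s *m invmx (f x)) @[s --> 0^'] -->
    - (invmx (f x) *m D *m invmx (f x)).
  apply: cvg_oppmx; apply: cvg_mulmx; last exact: cvg_cst.
  by apply: cvg_mulmx; [exact: fI|exact: fD].
apply: cvg_trans; apply: near_eq_cvg.
apply: filterS nU => s us.
rewrite /mxquot -scalemxAr -scalemxAl -scalerN; congr (_ *: _).
rewrite mulmxBr mulmxBl mulVmx // mul1mx -mulmxA mulmxV // mulmx1 opprB.
by [].
Qed.

Lemma is_mxderive0_cst p q (f : R -> 'M[R[i]]_(p, q)) :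
  (forall x, is_mxderive f x 0) -> forall x y, f x = f y.
Proof.
move=> f0 x y; apply/matrixP => k l.
have f0' z := (is_mxderiveP f z 0).1 (f0 z) k l.
rewrite [LHS]complexE [RHS]complexE; congr (_%:C + _ * _%:C).
  apply: (@is_derive_0_is_cst R (fun y => complex.Re (f y k l))) => z.
  by have [+ _] := f0' z; rewrite mxE.
apply: (@is_derive_0_is_cst R (fun y => complex.Im (f y k l))) => z.
by have [_ +] := f0' z; rewrite mxE.
Qed.

End DerivationRules.

Arguments is_mxderive_cst {R p q} A x.
Arguments is_mxderiveZ {R p q} c {f x D}.

(** * The fundamental theorem of calculus for the oriented integral *)

(** The one-sided theorem applies to [G y], the integral from a point [a] to the
    left of both [0] and [x]; near [x] the oriented integral is [G y - G 0],
    whatever the sign of [x]. *)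
Lemma is_derive_oint (R : realType) (f : R -> R) (x : R) :
  continuous f -> is_derive x 1 (oint f 0) (f x).
Proof.
move=> cf.
pose a := Order.min x 0 - 1; pose u := Order.max x 0 + 1.
have ax : a < x by rewrite /a ltrBlDr gt_min !ltrDl ltr01 ?orbT.
have a0 : a < 0 by rewrite /a ltrBlDr gt_min !ltrDl ltr01 ?orbT.
have xu : x < u by rewrite /u -ltrBlDr lt_max gtrBl ltr01.
have int v w : (@lebesgue_measure R).-integrable `[v, w] (EFin \o f).
  apply: continuous_compact_integrable; first exact: segment_compact.
  by apply: continuous_subspaceT.
pose G y := \int[lebesgue_measure]_(t in `[a, y]) f t.
have GB v w : a <= v -> v <= w -> \int[lebesgue_measure]_(t in `[v, w]) f t = G w - G v.
  move=> av vw; rewrite /G Rintegral_itvB ?bnd_simp//.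
  by rewrite Rintegral_itv_obnd_cbnd//;
  apply: integrableS (int v w) => //; apply: subset_itvr; rewrite bnd_simp.
have [dG G'] := continuous_FTC1_closed xu (int a u) ax (cf x).
have {dG G'} dG : is_derive x 1 G (f x).
  by split; [exact: dG|rewrite -derive1E; exact: G'].
have near_ax : \forall y \near x, a < y by apply: lt_nbhsr.
have E : \forall y \near x, G y - G 0 = oint f 0 y.
  apply: filterS near_ax => y ay; rewrite /oint; case: leP => y0.
    by rewrite GB // ltW.
  by rewrite GB ?ltW // opprB.
have Ex := nbhs_singleton E.
have {}dG := (is_deriveE G x (f x)).1 dG.
apply/is_deriveE; apply: cvg_trans _ dG; apply: near_eq_cvg.
have Es : \forall s \near 0^', G (s + x) - G 0 = oint f 0 (s + x) := cvg_shift0 E.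
by apply: filterS Es => s <-; rewrite -Ex opprB addrA subrK.
Qed.

Lemma is_mxderive_int (R : realType) p q (f : R -> 'M[R[i]]_(p, q)) x :
  (forall y, f z @[z --> y] --> f y) -> is_mxderive (mxint f 0) x (f x).
Proof.
move=> cf; apply/is_mxderiveP => k l.
have cRe : continuous (fun y => complex.Re (f y k l)).
  by move=> y; have /cvg_mxP/(_ k l)/cvg_complexP[] := cf y.
have cIm : continuous (fun y => complex.Im (f y k l)).
  by move=> y; have /cvg_mxP/(_ k l)/cvg_complexP[] := cf y.
split; under eq_fun do rewrite mxE.
  exact: is_derive_oint.
exact: is_derive_oint.
Qed.

Lemma mxint0 (R : realType) p q (f : R -> 'M[R[i]]_(p, q)) a : mxint f a a = 0.
Proof.
by apply/matrixP => k l; rewrite !mxE /oint lexx set_itv1 !Rintegral_set1.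
Qed.

(** * The matrix exponential *)

Lemma scalemx_exp (K : comNzRingType) n (c : K) (A : 'M[K]_n) k :
  (c *: A) ^+ k = c ^+ k *: A ^+ k.
Proof.
elim: k => [|k IH]; first by rewrite !expr0 scale1r.
by rewrite !exprS IH -[LHS]scalemxAl -scalemxAr scalerA.
Qed.

Section MatrixExponential.
Context (R : realType) (n : nat) (N : 'M[R[i]]_n).

(* The shift [m] makes these coefficients stable under term-by-term
   differentiation of the power series: it sends [m] to [m.+1]. *)
Let coef (i j : 'I_n) (m k : nat) : R[i] := (k`!%:R)^-1 * (N ^+ (k + m)) i j.

Let psum (x : R) := series (fun k => (k`!%:R)^-1 *: (x%:C *: N) ^+ k).

(** With [B] a bound of all entries of [N], the number [b = n B] works, since a
    product of two matrices is a sum of [n] products of entries. It dominates the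
    exponential series by that of [expR]. *)
Lemma expmx_entry_bound :
  exists2 b : R, 0 <= b & forall k i j, `|(N ^+ k) i j| <= (b ^+ k)%:C.
Proof.
pose B : R[i] := \sum_i \sum_j `|N i j|.
have NB i j : `|N i j| <= B.
  rewrite /B (bigD1 i) //= (bigD1 j) //= -addrA lerDl addr_ge0 //.
    exact: sumr_ge0.
  by apply: sumr_ge0 => *; apply: sumr_ge0.
have B0 : 0 <= B by apply: sumr_ge0 => *; apply: sumr_ge0.
have nB0 : 0 <= n%:R * B by rewrite mulr_ge0.
have nBE : n%:R * B = (complex.Re (n%:R * B))%:C by rewrite RRe_real // ger0_real.
exists (complex.Re (n%:R * B)); first by rewrite -ler0c -nBE.
move=> k; rewrite (rmorphXn (real_complex R)) /= -nBE; elim: k => [|k IH] i j.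
  by rewrite !expr0 mxE; case: (i == j); rewrite ?normr1 ?normr0.
rewrite exprS mxE; apply: le_trans (ler_norm_sum _ _ _) _.
have -> : (n%:R * B) ^+ k.+1 = \sum_(l < n) B * (n%:R * B) ^+ k.
  by rewrite sumr_const card_ord exprS -mulrA mulr_natl.
by apply: ler_sum => l _; rewrite normrM ler_pM.
Qed.

(* [L] stands for the real or the imaginary part: applied to an entry of
   [expmx (x%:C *: N)], each gives a real power series in [x]. *)
Section Coordinate.
Variable L : {additive R[i] -> R}.
Hypothesis LZ : forall z (x : R), L (z * x%:C) = L z * x.
Hypothesis Lnorm : forall z, `|L z|%:C <= `|z|.

Let is_cvg_coef i j m x : cvgn (pseries (L \o coef i j m) x).
Proof.
have [b b0 Nb] := expmx_entry_bound.
apply: normed_cvg.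
apply: (@series_le_cvg _ _ (fun k => b ^+ m * exp_coeff (b * `|x|) k)).
- by move=> k; exact: normr_ge0.
- move=> k; rewrite /exp_coeff /= mulr_ge0 ?exprn_ge0 //.
  by rewrite divr_ge0 ?exprn_ge0 ?mulr_ge0.
- move=> k; rewrite /exp_coeff /= normrM normrX exprMn.
  have : `|L (coef i j m k)| <= (k`!%:R)^-1 * b ^+ (k + m).
    rewrite -lecR (le_trans (Lnorm _)) // normrM rmorphM ler_pM //.
    by rewrite ger0_norm ?invr_ge0 // fmorphV rmorph_nat.
  move=> /(ler_wpM2r (exprn_ge0 k (normr_ge0 x))) /le_trans; apply.
  by rewrite exprD le_eqVlt; apply/orP; left; apply/eqP; ring.
- exact/is_cvg_seriesZ/is_cvg_series_exp_coeff.
Qed.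

Let diffs_coef i j m : pseries_diffs (L \o coef i j m) = L \o coef i j m.+1.
Proof.
apply/funext => k; rewrite /pseries_diffs /coef /= mulrC.
rewrite -LZ rmorph_nat addSnnS factS natrM invfM; congr (L _).
by rewrite mulrC !mulrA mulfV ?mul1r // pnatr_eq0.
Qed.

Let L_psum x k i j : L (psum x k i j) = pseries (L \o coef i j 0) x k.
Proof.
rewrite /psum /pseries /series /= summxE raddf_sum; apply: eq_bigr => l _.
rewrite /coef addn0 -LZ; congr (L _).
rewrite mxE rmorphXn -mulrA; congr (_ * _).
by rewrite scalemx_exp mxE mulrC.
Qed.
Let L_mul_psum x k i j : L ((N *m psum x k) i j) = pseries (L \o coef i j 1) x k.
Proof.
rewrite /psum /pseries /series /= mulmx_sumr summxE raddf_sum.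
apply: eq_bigr => l _.
rewrite /coef -LZ; congr (L _).
rewrite scalemx_exp scalerA -scalemxAr mxE rmorphXn addn1 exprS.
by rewrite -mulmxE mulrAC.
Qed.

Lemma is_cvg_L_psum (x : R) i j : cvgn (fun k => L (psum x k i j)).
Proof. by under eq_fun do rewrite L_psum; apply: is_cvg_coef. Qed.

(** Differentiating the power series term by term multiplies the partial sums by
    [N]. *)
Lemma is_derive_L_psum (x : R) i j :
  is_derive x 1 (fun y => limn (fun k => L (psum y k i j)))
    (limn (fun k => L ((N *m psum x k) i j))).
Proof.
have -> : (fun y => limn (fun k => L (psum y k i j))) =
    (fun y => limn (pseries (L \o coef i j 0) y)).
  by apply/funext => y; congr (limn _); apply/funext => k; apply: L_psum.
have -> : (fun k => L ((N *m psum x k) i j)) = pseries (L \o coef i j 1) x.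
  by apply/funext => k; apply: L_mul_psum.
rewrite -diffs_coef.
(* The radius of convergence is infinite; any number beyond [`|x|] will do. *)
apply: (@pseries_snd_diffs R _ (`|x| + 1)).
- exact: is_cvg_coef.
- by rewrite diffs_coef; exact: is_cvg_coef.
- by rewrite !diffs_coef; exact: is_cvg_coef.
- by rewrite [ltRHS]ger0_norm ?addr_ge0 // ltrDl.
Qed.

End Coordinate.

Let ReZ z (x : R) : complex.Re (z * x%:C) = complex.Re z * x.
Proof. by case: z => a b; simpc. Qed.
Let ImZ z (x : R) : complex.Im (z * x%:C) = complex.Im z * x.
Proof. by case: z => a b; simpc. Qed.

Lemma expmx_cvg (x : R) : psum x k @[k --> \oo] --> expmx (x%:C *: N).
Proof.
suff [M PM] : exists M, psum x k @[k --> \oo] --> (M : 'M[R[i]]_n).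
  suff -> : expmx (x%:C *: N) = M by [].
  exact: cvg_mx_lim PM.
exists (\matrix_(i, j) (limn (fun k => complex.Re (psum x k i j)) +i*
                        limn (fun k => complex.Im (psum x k i j)))).
apply/cvg_mxP => i j; rewrite mxE; apply/cvg_complexP; split.
  exact: (is_cvg_L_psum ReZ (@normc_ge_Re R)).
exact: (is_cvg_L_psum ImZ (@normc_ge_Im R)).
Qed.

Lemma is_mxderive_expmx (x : R) :
  is_mxderive (fun y => expmx (y%:C *: N)) x (N *m expmx (x%:C *: N)).
Proof.
have E (y : R) i j :
    (complex.Re (psum y k i j) @[k --> \oo] --> complex.Re (expmx (y%:C *: N) i j)) /\
    (complex.Im (psum y k i j) @[k --> \oo] --> complex.Im (expmx (y%:C *: N) i j)).
  by apply/cvg_complexP; move: i j; apply/cvg_mxP; exact: expmx_cvg.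
have NE : N *m psum x k @[k --> \oo] --> N *m expmx (x%:C *: N).
  by apply: cvg_mulmx; [exact: cvg_cst|exact: expmx_cvg].
apply/is_mxderiveP => i j.
have /cvg_mxP/(_ i j)/cvg_complexP[/cvg_lim rE /cvg_lim iE] := NE.
rewrite -rE // -iE //; split.
  rewrite (_ : (fun y => _) = (fun y => limn (fun k => complex.Re (psum y k i j)))).
    exact: (is_derive_L_psum ReZ (@normc_ge_Re R)).
  by apply/funext => y; have [/cvg_lim<-] := E y i j.
rewrite (_ : (fun y => _) = (fun y => limn (fun k => complex.Im (psum y k i j)))).
  exact: (is_derive_L_psum ImZ (@normc_ge_Im R)).
by apply/funext => y; have [_ /cvg_lim<-] := E y i j.
Qed.

End MatrixExponential.

Arguments is_mxderive_expmx {R n} N x.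

Lemma expmx0 (R : realType) n : expmx (0 : 'M[R[i]]_n) = 1%:M.
Proof.
apply: cvg_mx_lim; apply/cvg_mxP => i j.
(* Every nonempty partial sum is the identity. *)
rewrite -cvg_shiftS /=.
under eq_fun => k.
  rewrite /series /= big_nat_recl // big1 ?addr0; last first.
    by move=> l _; rewrite exprS mul0r scaler0.
  rewrite expr0 fact0 invr1 scale1r.
  over.
exact: cvg_cst.
Qed.

(** * Matrix identities behind the transformation *)

Lemma adjmxM (R : realType) p q r (A : 'M[R[i]]_(p, q)) (B : 'M[R[i]]_(q, r)) :
  (A *m B)^t* = B^t* *m A^t*.
Proof. by rewrite trmx_mul map_mxM. Qed.

Lemma adjmxN (R : realType) p q (A : 'M[R[i]]_(p, q)) : (- A)^t* = - A^t*.
Proof. by rewrite raddfN /= map_mxN. Qed.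

(** Here [phi'] and [chi'] are the derivatives found below for
    [phi = (adj Lambda2) S^-1] and [chi = (adj Lambda1) S^-1], and the left-hand
    side is what the product rule gives for [phi'']: the terms in
    [phi *m L2 *m chi] cancel and all others but [phi *m A] factor through
    [phi] on the right. *)
Lemma schrodinger_algebra (K : comNzRingType) n h (A : 'M[K]_n)
    (L1 L2 : 'M[K]_(n, h)) (phi chi : 'M[K]_(h, n)) :
  let phi' := - chi - phi *m L2 *m phi in
  let chi' := phi *m A - phi *m L1 *m phi + phi *m L2 *m chi
              - chi *m L2 *m phi in
  - chi' - ((phi' *m L2 - phi *m L1) *m phi + phi *m L2 *m phi') =
  - (phi *m A) + (2 *: (chi *m L2 + phi *m L1 + phi *m L2 *m (phi *m L2))) *m phi.
Proof.
rewrite /= -scalemxAl !(mulmxDl, mulmxDr, mulmxN, mulNmx) !mulmxA.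
set a := phi *m A; set b := phi *m L1 *m phi; set c := phi *m L2 *m chi.
set d := chi *m L2 *m phi; set e := _ *m phi *m L2 *m phi.
by apply/matrixP => i j; rewrite !mxE; ring.
Qed.

(** The hypothesis multiplied by [S^-1] on both sides. With [B = adj A] it trades
    the [adj A] which appears on the left of [S^-1] for an [A] on its right, next
    to the time factor [expmx (- i t A)]. *)
Lemma invmx_intertwining (K : comUnitRingType) n h (A B S : 'M[K]_n)
    (L1 L2 : 'M[K]_(n, h)) (L1s L2s : 'M[K]_(h, n)) :
  S \in unitmx -> A *m S - S *m B = L1 *m L2s - L2 *m L1s ->
  B *m invmx S = invmx S *m A - invmx S *m L1 *m (L2s *m invmx S)
                 + invmx S *m L2 *m (L1s *m invmx S).
Proof.
move=> uS /(congr1 (fun M => invmx S *m M *m invmx S)).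
rewrite !(mulmxBr, mulmxBl) !mulmxA mulmxK // mulVmx // mul1mx => H.
by rewrite -addrA [- _ + _]addrC -opprB -H subKr.
Qed.

(** * The transformed wave function *)

Section Darboux.
Context (R : realType) (n h : nat).
Variables (A Q S0 : 'M[R[i]]_n) (f1 f2 : 'M[R[i]]_(n, h)).
Hypothesis QA : Q *m Q = A.

Local Notation L1 := (Lambda1 Q f1 f2).
Local Notation L2 := (Lambda2 Q f1 f2).
Local Notation S := (SX Q S0 f1 f2).

Let scale_i (N : 'M[R[i]]_n) (x : R) : ('i * x%:C) *: N = x%:C *: ('i *: N).
Proof. by rewrite scalerA mulrC. Qed.
Let scale_Ni (N : 'M[R[i]]_n) (x : R) : (- ('i * x%:C)) *: N = x%:C *: (- 'i *: N).
Proof. by rewrite scalerA mulrN mulrC. Qed.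

Let Eplus (x : R) := expmx (('i * x%:C) *: Q) *m f1.
Let Eminus (x : R) := expmx ((- ('i * x%:C)) *: Q) *m f2.

Let Lambda1E x : L1 x = - 'i *: (Q *m (Eplus x - Eminus x)).
Proof. by []. Qed.

Let Lambda2E x : L2 x = Eplus x + Eminus x.
Proof. by []. Qed.

Let is_mxderive_Eplus x : is_mxderive Eplus x ('i *: (Q *m Eplus x)).
Proof.
apply: eq_is_mxderive
  (is_mxderiveM (is_mxderive_expmx ('i *: Q) x) (is_mxderive_cst f1 x)) _ _.
  by move=> y; rewrite /Eplus scale_i.
by rewrite mulmx0 addr0 -mulmxA -scalemxAl /Eplus scale_i.
Qed.

Let is_mxderive_Eminus x : is_mxderive Eminus x (- 'i *: (Q *m Eminus x)).
Proof.
apply: eq_is_mxderive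
  (is_mxderiveM (is_mxderive_expmx (- 'i *: Q) x) (is_mxderive_cst f2 x)) _ _.
  by move=> y; rewrite /Eminus scale_Ni.
by rewrite mulmx0 addr0 -mulmxA -scalemxAl /Eminus scale_Ni.
Qed.

Arguments is_mxderive_Eplus x : clear implicits.
Arguments is_mxderive_Eminus x : clear implicits.

Lemma is_mxderive_Lambda2 x : is_mxderive L2 x (- L1 x).
Proof.
apply: eq_is_mxderive
  (is_mxderiveD (is_mxderive_Eplus x) (is_mxderive_Eminus x)) (fun=> erefl) _.
rewrite Lambda1E; move: (Eplus x) (Eminus x) => U V.
by rewrite mulmxBr scalerBr !scaleNr opprD !opprK.
Qed.

Arguments is_mxderive_Lambda2 x : clear implicits.

Lemma is_mxderive_Lambda1 x : is_mxderive L1 x (A *m L2 x).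
Proof.
have D := is_mxderiveD (is_mxderive_Eplus x) (is_mxderiveN (is_mxderive_Eminus x)).
apply: eq_is_mxderive
  (is_mxderiveZ (- 'i) (is_mxderiveM (is_mxderive_cst Q x) D)) _ _.
  by move=> y; rewrite Lambda1E.
rewrite Lambda2E; move: (Eplus x) (Eminus x) => U V.
rewrite mul0mx add0r (scaleNr 'i (Q *m V)) opprK -scalerDr -mulmxDr.
rewrite -scalemxAr scaleNr scalerA -expr2 sqr_i scaleN1r opprK.
by rewrite mulmxA QA.
Qed.

Arguments is_mxderive_Lambda1 x : clear implicits.

Lemma is_mxderive_SX x : is_mxderive S x (L2 x *m (L2 x)^t*).
Proof.
have dI : is_mxderive (mxint (fun y => L2 y *m (L2 y)^t*) 0) x
    (L2 x *m (L2 x)^t*).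
  apply: (@is_mxderive_int R _ _ (fun y => L2 y *m (L2 y)^t*)) => y.
  have L2y := is_mxderive_cvg (is_mxderive_Lambda2 y).
  by apply: cvg_mulmx; [exact: L2y|apply: cvg_adjmx; exact: L2y].
apply: eq_is_mxderive (is_mxderiveD (is_mxderive_cst S0 x) dI) (fun=> erefl) _.
by rewrite add0r.
Qed.

Arguments is_mxderive_SX x : clear implicits.

(** The identity assumed at [0] propagates: by the formulas for the derivatives of
    [Lambda1], [Lambda2] and [S], the difference of the two sides has derivative
    zero. *)
Lemma SX_identity theta1 theta2 :
  A *m S0 - S0 *m A^t* = row_mx theta1 theta2 *m jmx R h *m (row_mx theta1 theta2)^t* ->
  (- 'i) *: (Q *m (f1 - f2)) = theta1 -> f1 + f2 = theta2 ->
  forall x, A *m S x - S x *m A^t* = L1 x *m (L2 x)^t* - L2 x *m (L1 x)^t*.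
Proof.
move=> AS0 Ef1 Ef2 x.
have i0 : 'i * (0 : R)%:C = 0 by rewrite mulr0.
have L10 : L1 0 = theta1.
  by rewrite /Lambda1 i0 oppr0 !scale0r expmx0 !mul1mx.
have L20 : L2 0 = theta2.
  by rewrite /Lambda2 i0 oppr0 !scale0r expmx0 !mul1mx.
pose W x := A *m S x - S x *m A^t* - (L1 x *m (L2 x)^t* - L2 x *m (L1 x)^t*).
suff W0 : W x = 0 by apply/eqP; rewrite -subr_eq0; apply/eqP.
have -> : W x = W 0.
  apply: is_mxderive0_cst => y.
  have dA := is_mxderive_cst A y.
  have dA' := is_mxderive_cst (A^t*) y.
  have dS := is_mxderive_SX y.
  have d1 := is_mxderive_Lambda1 y.
  have d2 := is_mxderive_Lambda2 y.
  have dL := is_mxderiveD (is_mxderiveM dA dS) (is_mxderiveN (is_mxderiveM dS dA')).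
  have dR := is_mxderiveD (is_mxderiveM d1 (is_mxderive_adj d2))
    (is_mxderiveN (is_mxderiveM d2 (is_mxderive_adj d1))).
  apply: eq_is_mxderive (is_mxderiveD dL (is_mxderiveN dR)) (fun=> erefl) _.
  rewrite adjmxN adjmxM !(mul0mx, mulmx0, mulNmx, mulmxN) !mulmxA.
  by apply/matrixP => i j; rewrite !mxE; ring.
rewrite /W /SX mxint0 addr0 AS0 L10 L20 /jmx.
rewrite mul_row_block !mulmx0 !mulmxN !mulmx1 add0r addr0.
rewrite tr_row_mx map_col_mx mul_row_col mulNmx.
by rewrite [- _ + _]addrC subrr.
Qed.

(** The factor of the wave function that does not depend on time. *)
Definition phi x := (L2 x)^t* *m invmx (S x).
Definition chi x := (L1 x)^t* *m invmx (S x).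
Definition phi' x := - chi x - phi x *m L2 x *m phi x.

Lemma is_mxderive_phi x : S x \in unitmx -> is_mxderive phi x (phi' x).
Proof.
move=> ux.
apply: eq_is_mxderive (is_mxderiveM (is_mxderive_adj (is_mxderive_Lambda2 x))
  (is_mxderive_inv ux (is_mxderive_SX x))) (fun=> erefl) _.
by rewrite /phi' /chi /phi adjmxN mulNmx mulmxN !mulmxA.
Qed.

(* The conclusion of [SX_identity]. *)
Hypothesis SA : forall x,
  A *m S x - S x *m A^t* = L1 x *m (L2 x)^t* - L2 x *m (L1 x)^t*.

Lemma is_mxderive_chi x : S x \in unitmx ->
  is_mxderive chi x (phi x *m A - phi x *m L1 x *m phi x
    + phi x *m L2 x *m chi x - chi x *m L2 x *m phi x).
Proof.
move=> ux.
apply: eq_is_mxderive (is_mxderiveM (is_mxderive_adj (is_mxderive_Lambda1 x))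
  (is_mxderive_inv ux (is_mxderive_SX x))) (fun=> erefl) _.
have E := invmx_intertwining ux (SA x).
rewrite adjmxM -(mulmxA _ (A^t*)) E /phi /chi.
move: (invmx (S x)) ((L1 x)^t*) ((L2 x)^t*) => Si M1s M2s.
by rewrite mulmxDr mulmxBr mulmxN !mulmxA.
Qed.

Lemma is_mxderive_phi' x : S x \in unitmx ->
  is_mxderive phi' x (- (phi x *m A) + utilde Q S0 f1 f2 x *m phi x).
Proof.
move=> ux.
have dphi := is_mxderive_phi ux.
apply: eq_is_mxderive (is_mxderiveD (is_mxderiveN (is_mxderive_chi ux))
  (is_mxderiveN (is_mxderiveM (is_mxderiveM dphi (is_mxderive_Lambda2 x)) dphi)))
  (fun=> erefl) _.
by rewrite mulmxN schrodinger_algebra.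
Qed.

Lemma psitildeE x t :
  psitilde A Q S0 f1 f2 x t = phi x *m expmx ((- ('i * t%:C)) *: A).
Proof.
by rewrite /psitilde /PiX tr_row_mx map_col_mx mul_row_col mul0mx add0r mul1mx.
Qed.

Lemma is_mxderive_psitilde_time x t :
  is_mxderive (psitilde A Q S0 f1 f2 x) t
    (phi x *m ((- 'i *: A) *m expmx ((- ('i * t%:C)) *: A))).
Proof.
apply: eq_is_mxderive
  (is_mxderiveM (is_mxderive_cst (phi x) t) (is_mxderive_expmx (- 'i *: A) t)) _ _.
  by move=> s; rewrite psitildeE scale_Ni.
by rewrite mul0mx add0r scale_Ni.
Qed.

End Darboux.

Arguments is_mxderive_SX {R n h} Q S0 f1 f2 x.
Arguments is_mxderive_psitilde_time {R n h} A Q S0 f1 f2 x t.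

Theorem theorem2p5 (R : realType) (n h : nat) (n_gt0 : (0 < n)%N)
    (h_gt0 : (0 < h)%N) (I : interval R) (I0 : 0 \in I)
    (A S0 : 'M[R[i]]_n) (theta1 theta2 : 'M[R[i]]_(n, h))
    (Pi0 : 'M[R[i]]_(n, h + h)) (defPi0 : Pi0 = row_mx theta1 theta2)
    (AS0 : A *m S0 - S0 *m A^t* = Pi0 *m jmx R h *m Pi0^t*)
    (S0_adj : S0 = S0^t*)
    (Q : 'M[R[i]]_n) (QA : Q *m Q = A)
    (f1 f2 : 'M[R[i]]_(n, h))
    (Ef1 : (- 'i) *: (Q *m (f1 - f2)) = theta1) (Ef2 : f1 + f2 = theta2)
    (x : R) (xI : x \in I) (Sx : SX Q S0 f1 f2 x \in unitmx) (t : R) :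
  let psi := psitilde A Q S0 f1 f2 in
  [/\ mxderivable (fun s => psi x s) t,
      \forall y \near x, mxderivable (fun z => psi z t) y,
      mxderivable (fun y => mxderive (fun z => psi z t) y) x &
      'i *: mxderive (fun s => psi x s) t
      = - mxderive (fun y => mxderive (fun z => psi z t) y) x
        + utilde Q S0 f1 f2 x *m psi x t].
Proof.
rewrite /= => {n_gt0 h_gt0 I I0 xI S0_adj}; subst Pi0.
have SA := SX_identity QA AS0 Ef1 Ef2.
set psi := psitilde A Q S0 f1 f2.
pose E := expmx ((- ('i * t%:C)) *: A).
have dt := is_mxderive_psitilde_time A Q S0 f1 f2 x t.
have dx y : SX Q S0 f1 f2 y \in unitmx ->
    is_mxderive (fun z => psi z t) y (phi' Q S0 f1 f2 y *m E).
  move=> uy.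
  apply: eq_is_mxderive
    (is_mxderiveM (is_mxderive_phi uy) (is_mxderive_cst E y)) _ _.
    by move=> z; rewrite /psi psitildeE.
  by rewrite mulmx0 addr0.
(* [S] is differentiable, so it is invertible near [x] and the first derivative
   is given by the same formula there. *)
have nU := is_mxderive_near_unit Sx (is_mxderive_SX Q S0 f1 f2 x).
have dxx : is_mxderive (fun y => mxderive (fun z => psi z t) y) x
    ((- (phi Q S0 f1 f2 x *m A) + utilde Q S0 f1 f2 x *m phi Q S0 f1 f2 x) *m E).
  have := is_mxderiveM (is_mxderive_phi' QA SA Sx) (is_mxderive_cst E x).
  move/is_mxderive_near => dn.
  apply: eq_is_mxderive (dn _ _) (fun=> erefl) _.
    by apply: filterS nU => y /dx /is_mxderive_val[_ ->].
  by rewrite mulmx0 addr0.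
have [mt Et] := is_mxderive_val dt.
have [mxx Exx] := is_mxderive_val dxx.
split.
- exact: mt.
- by apply: filterS nU => y /dx /is_mxderive_val[].
- exact: mxx.
apply: (eq_trans (congr1 (fun M => 'i *: M) Et)).
apply: (eq_trans _ (congr1 (fun M => - M + utilde Q S0 f1 f2 x *m psi x t)
  (esym Exx))).
rewrite /psi psitildeE -/E.
move: (phi Q S0 f1 f2 x) (utilde Q S0 f1 f2 x) E {dt dx dxx Et Exx mt mxx} => p u E.
rewrite mulmxDl mulNmx opprD opprK !mulmxA subrK.
rewrite -scalemxAr -scalemxAl scalerA mulrN -expr2 sqr_i opprK scale1r.
by [].
Qed.
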